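(* Let $m\ge 2$, let $C\subseteq(\mathbb{Z}/m\mathbb{Z})^n$ be an $m$-ary linear code of length $n$ and let $\Lambda_{A(C)}$ be the associated Construction A lattice. Then for $0\le q<1$ the $\Theta^1$-function of $\Lambda_{A(C)}$ is given by $$\Theta^1_{\Lambda_{A(C)}}(q)=\frac{1}{(1-q^m)^n}\, swe_C\!\left(1+q^m,\;q+q^{m-1},\;\dots,\; q^{\lfloor\frac{m}{2}\rfloor}+q^{m-\lfloor\frac{m}{2}\rfloor}\right).$$
   Context: An $m$-ary linear code of length $n$ is a $\mathbb{Z}$-submodule $C$ of $(\mathbb{Z}/m\mathbb{Z})^n$. The Construction A lattice of $C$ is $\Lambda_{A(C)}=\{x\in\mathbb{Z}^n: x \bmod m\in C\}$. The symmetric weight enumerator of $C$ is the homogeneous polynomial of degree $n$ in $\lfloor m/2\rfloor+1$ variables $$swe_C(x_0,x_1,\dots,x_{\lfloor m/2\rfloor})=\sum_{c\in C}x_0^{n_0(c)}x_1^{n_1(c)}\cdots x_{\lfloor m/2\rfloor}^{n_{\lfloor m/2\rfloor}(c)},$$ where $n_i(c)$ is the number of coordinates of $c$ congruent to $\pm i\pmod m$. For a lattice $\Lambda\subseteq\mathbb{R}^n$, $\Theta^1_\Lambda(q)=\sum_{x\in\Lambda}q^{\|x\|_1}$ for real $0\le q<1$, where $\|x\|_1=\sum_i|x_i|$. *)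

(* Defs.v *)
From mathcomp Require Import all_boot all_order all_algebra.
From mathcomp Require Import all_classical all_reals all_analysis.
(* The notations of mpoly clash with those of MathComp-Analysis. *)
From mathcomp Require mpoly.
Import (canonicals) mpoly.

Set Implicit Arguments.
Unset Strict Implicit.
Unset Printing Implicit Defensive.

Import Order.TTheory GRing.Theory Num.Theory.

Local Open Scope classical_set_scope.
Local Open Scope ring_scope.

(* 'Z_m is Z/mZ only for 1 < m; the definitions are meant for such m. *)

(* A Z-submodule of an abelian group is the same thing as an additive
   subgroup. *)
Definition linear_code (m n : nat) (C : {set 'rV['Z_m]_n}) : Prop :=
  GRing.zmod_closed C.

Definition reduce_mod (m n : nat) (z : 'rV[int]_n) : 'rV['Z_m]_n :=
  \row_(j < n) (z 0 j)%:~R.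

(* The lattice is a subset of R^n, consisting of integer vectors. *)
Definition constructionA (R : realType) (m n : nat) (C : {set 'rV['Z_m]_n}) :
    set 'rV[R]_n :=
  [set x | exists2 z : 'rV[int]_n,
             reduce_mod m z \in C & x = \row_(j < n) (z 0 j)%:~R].
Arguments constructionA R [m n] C _.

(* A coordinate satisfying both congruences (i = 0 or 2i = m) counts once. *)
Definition ncoord (m n : nat) (i : nat) (c : 'rV['Z_m]_n) : nat :=
  #|[pred j : 'I_n | (c 0 j == i%:R) || (c 0 j == - i%:R)]|.

(* The variables x_0, ..., x_{floor(m/2)} are indexed by 'I_(m./2).+1. *)
Definition swe (R : comNzRingType) (m n : nat) (C : {set 'rV['Z_m]_n}) :
    mpoly.mpoly (m./2).+1 R :=
  \sum_(c in C) \prod_(i < (m./2).+1)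
     mpoly.mpolyX R (mpoly.mnm1 i) ^+ ncoord i c.

Definition norm1 (R : realType) (n : nat) (x : 'rV[R]_n) : R :=
  \sum_(j < n) `|x 0 j|.

(* For q >= 0 the terms are nonnegative, so the unordered sum is their sum in
   [0, +oo]; at q = 0 one has 0 `^ 0 = 1 and 0 `^ t = 0 for t != 0. *)
Definition Theta1 (R : realType) (n : nat) (L : set 'rV[R]_n) (q : R) :
    \bar R :=
  \esum_(x in L) (q `^ norm1 x)%:E.

(* Main.v *)
(* The terms q^|x|_1 are nonnegative and factor over the coordinates, so the
   lattice sum splits over the codewords c into products over j of the sums of
   q^|z| over the integers z congruent to c_j mod m.  Writing r for the
   representative of c_j in [0, m), such z are r + k m and -((m - r) + k m) with
   k >= 0, whence two geometric series with sum (q^r + q^(m-r)) / (1 - q^m).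
   This is invariant under r -> m - r, so it depends only on which of the classes
   +-i, 0 <= i <= m/2, contains c_j; grouping equal factors gives the
   monomials of swe. *)

Require Import Defs.
From mathcomp Require Import all_boot all_order all_algebra.
From mathcomp Require Import all_classical all_reals all_analysis.
From mathcomp Require mpoly.
Import (canonicals) mpoly.
From mathcomp Require Import zify.

Import Order.TTheory GRing.Theory Num.Theory.

Local Open Scope ring_scope.

(** [esum] is a supremum of finite partial sums, and scaling by a nonnegative real commutes with the
    supremum of a nonempty set; the empty sum is a member. *)
Lemma ge0_esumZl (R : realType) (T : choiceType) (D : set T)
    (a : T -> \bar R) (k : R) :
  0 <= k -> (forall x, (0 <= a x)%E) ->
  (\esum_(x in D) (k%:E * a x) = k%:E * \esum_(x in D) a x)%E.
Proof.
move=> k0 a0; rewrite /esum -ereal_supZl //; last first.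
  by apply/set0P; exists 0%E, set0; [exact: fsets_set0 | rewrite fsbig_set0].
congr ereal_sup; apply/seteqP; split => [_ [X DX <-]|_ [_ [X DX <-] <-]].
  exists (\sum_(x \in X) a x)%E; first by exists X.
  by rewrite ge0_mule_fsumr.
by exists X => //; rewrite ge0_mule_fsumr.
Qed.

(** Once terms are extended by zero, all sums run over [T]. The finite sum and [esum] then swap, and
    at each [x] only the index [f x] can contribute. *)
Lemma esum_partition_fin (R : realType) (T : choiceType) (I : finType)
    (f : T -> I) (A : {set I}) (a : T -> \bar R) :
  (forall x, (0 <= a x)%E) ->
  (\esum_(x in [set x | f x \in A]) a x =
   \sum_(i in A) \esum_(x in [set x | f x = i]) a x)%E.
Proof.
move=> a0; rewrite esum_mkcond.
under [RHS]eq_bigr do rewrite esum_mkcond.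
rewrite -esum_sum; last by move=> x i _ _; case: ifP.
apply: eq_esum => x _.
rewrite (_ : (x \in [set y | f y \in A]%classic) = (f x \in A)); last first.
  by apply/idP/idP; rewrite inE.
under eq_bigr => i _.
  rewrite (_ : (x \in [set y | f y = i]%classic) = (i == f x)); last first.
    by rewrite eq_sym; apply/idP/eqP; rewrite inE.
  over.
rewrite -big_mkcondr; case: ifPn => fA.
  rewrite (big_pred1 (f x)) // => i /=.
  by case: eqP => [->|]; rewrite ?fA ?andbF.
by rewrite big_pred0 // => i /=; case: eqP => [->|]; rewrite ?(negbTE fA) ?andbF.
Qed.

(** Tonelli for nonnegative terms, by induction on [n]: coordinate 0 is split off, and the product
    of two sums becomes an iterated sum, then a sum over pairs. *)
Lemma esum_prod (R : realType) (T : choiceType) (n : nat)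
    (D : 'I_n -> set T) (F : 'I_n -> T -> R) (S : 'I_n -> R) :
  (forall j t, 0 <= F j t) ->
  (forall j, \esum_(t in D j) (F j t)%:E = (S j)%:E) ->
  \esum_(z in [set z : 'rV[T]_n | forall j, D j (z 0 j)])
    (\prod_(j < n) F j (z 0 j))%:E = (\prod_(j < n) S j)%:E.
Proof.
elim: n D F S => [|n IHn] D F S F0 DS.
  (* [T] may be empty, so the unique row of length 0 comes from the empty function. *)
  have t0 : 'I_0 -> T by case.
  pose z : 'rV[T]_0 := \row_j t0 j.
  rewrite (_ : [set _ | _]%classic = [set z]%classic); last first.
    by apply/seteqP; split=> w _; [apply/rowP|] => -[].
  by rewrite esum_set1 !big_ord0 // lee_fin.
have S0 j : 0 <= S j.
  by rewrite -lee_fin -DS esum_ge0 // => t _; rewrite lee_fin.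
pose D' j := D (lift ord0 j); pose F' j := F (lift ord0 j).
pose P' (z : 'rV[T]_n) := \prod_(j < n) F' j (z 0 j).
have P'0 z : (0 <= (P' z)%:E)%E.
  by rewrite lee_fin prodr_ge0 // => j _; exact: F0.
rewrite big_ord_recl mulrC EFinM -DS -ge0_esumZl ?prodr_ge0 //; last first.
  by move=> t; rewrite lee_fin.
under [RHS]eq_esum => t _.
  rewrite muleC -(IHn D' F' _ (fun j => F0 _) (fun j => DS _)).
  rewrite -(@ge0_esumZl _ _ _ (fun z => (P' z)%:E)) //.
  over.
rewrite esum_esum; last by move=> t z _ _; rewrite mule_ge0 // lee_fin.
(* Prepending a coordinate is the bijection from pairs to rows of length [n.+1] that reindexes the
   sum. *)
pose e (p : T * 'rV[T]_n) : 'rV[T]_n.+1 :=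
  \row_j if unlift ord0 j is Some j' then p.2 0 j' else p.1.
have e0 p : e p 0 ord0 = p.1 by rewrite mxE unlift_none.
have eS p j : e p 0 (lift ord0 j) = p.2 0 j by rewrite mxE liftK.
rewrite (reindex_esum
  (D ord0 `*`` (fun=> [set z : 'rV[T]_n | forall j, D' j (z 0 j)]))%classic _ e).
  apply: eq_esum => p _; rewrite -EFinM big_ord_recl e0; congr (_ * _)%:E.
  by apply: eq_bigr => j _; rewrite eS.
split.
- move=> p [/= Dp1 Dp2] j.
  by case: (unliftP ord0 j) => [j'|] ->; rewrite ?eS ?e0 //; exact: Dp2.
- move=> [t z] [t' z'] _ _ /= ezz'; congr pair.
    by rewrite -[t](e0 (t, z)) ezz' e0.
  by apply/rowP => j; rewrite -[z _ _](eS (t, z)) ezz' eS.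
- move=> z Dz; exists (z 0 ord0, \row_j z 0 (lift ord0 j)).
    by split=> //= j; rewrite mxE.
  by apply/rowP => j; case: (unliftP ord0 j) => [j'|] ->; rewrite ?eS ?e0 ?mxE.
Qed.

Lemma esum_geometric (R : realType) (q : R) (a m : nat) :
  0 <= q -> q < 1 -> (0 < m)%N ->
  \esum_(k in [set: nat]) (q ^+ (a + k * m))%:E = (q ^+ a / (1 - q ^+ m))%:E.
Proof.
move=> q0 q1 m0.
have qm1 : `|q ^+ m| < 1.
  by rewrite ger0_norm ?exprn_ge0 // exprn_ilt1 // -lt0n.
rewrite -nneseries_esumT => [|k]; last by rewrite lee_fin exprn_ge0.
apply/cvg_lim => //.
rewrite (_ : (fun _ => _) = EFin \o series (geometric (q ^+ a) (q ^+ m))).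
  apply: cvg_EFin; first by apply: nearW.
  exact: cvg_geometric_series.
apply/funext => k; rewrite /= /series /= sumEFin; congr _%:E.
by apply: eq_bigr => i _; rewrite exprD mulnC exprM.
Qed.

Lemma eqr_nat_Zp (m r k : nat) : (1 < m)%N ->
  (k%:R == r%:R :> 'Z_m) = (k == r %[mod m]).
Proof. by move=> m1; rewrite -val_eqE /= !val_Zp_nat. Qed.

Lemma eq_oppr_nat_Zp (m r k : nat) : (1 < m)%N ->
  (- k%:R == r%:R :> 'Z_m) = (m %| k + r)%N.
Proof.
move=> m1; rewrite eq_sym -addr_eq0 -natrD -[0]/(0%:R) eqr_nat_Zp //.
by rewrite mod0n addnC.
Qed.

Lemma esum_residue (R : realType) (q : R) (m r : nat) :
  0 <= q -> q < 1 -> (1 < m)%N -> (r < m)%N ->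
  \esum_(z in [set z : int | z%:~R = r%:R :> 'Z_m]) (q ^+ `|z|%N)%:E =
  ((q ^+ r + q ^+ (m - r)) / (1 - q ^+ m))%:E.
Proof.
move=> q0 q1 m1 rm.
rewrite (esumID [set z : int | 0 <= z]) => [|z _]; last first.
  by rewrite lee_fin exprn_ge0.
rewrite (_ : _ `&` [set z : int | 0 <= z] =
    (fun k : nat => Posz (r + k * m)) @` setT)%classic; last first.
  apply/seteqP; split => [[k|k] [] //= /eqP|_ [k _ <-] /=].
    rewrite -pmulrn eqr_nat_Zp // => /eqP kr _.
    exists (k %/ m)%N => //; rewrite {2}(divn_eq k m) kr modn_small //.
    by rewrite addnC.
  split=> //; apply/eqP; rewrite -pmulrn eqr_nat_Zp //.
  by rewrite addnC modnMDl.
rewrite (_ : _ `&` ~` [set z : int | 0 <= z] =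
    (fun k : nat => - Posz ((m - r) + k * m)) @` setT)%classic; last first.
  apply/seteqP; split => [[k|k] [] //= /eqP|_ [k _ <-] /=].
    (* Here z = -(k+1) and m divides k+1+r > 0, so the quotient is some d+1 and k+1 = (m-r) + d
       m. *)
    rewrite NegzE mulrNz -pmulrn eq_oppr_nat_Zp // => /dvdnP[[//|d] kr] _.
    exists d => //; congr (- Posz _).
    by apply/eqP; rewrite -(eqn_add2r r) kr mulSn addnAC subnK // ltnW.
  (* Since r < m, these integers are strictly negative, so 0 is not counted twice. *)
  split; last by apply/negP; rewrite -ltNge; lia.
  apply/eqP; rewrite mulrNz -pmulrn eq_oppr_nat_Zp //.
  by rewrite addnAC subnK ?(ltnW rm) // -mulSn dvdn_mull.
rewrite !esum_image; first last.
- by move=> k l _ _ []; nia.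
- by move=> k l _ _ /oppr_inj []; nia.
under eq_esum do rewrite absz_nat.
under [X in (_ + X)%E]eq_esum do rewrite abszN absz_nat.
by rewrite !esum_geometric ?(ltnW m1) // mulrDl.
Qed.

(* The class of c_j is represented by i = min (c_j, m - c_j). *)
Lemma prod_exp_ncoord (R : comNzRingType) (m n : nat) (c : 'rV['Z_m]_n)
    (g : nat -> R) :
  (1 < m)%N -> (forall r, (r < m)%N -> g (m - r)%N = g r) ->
  \prod_(i < (m./2).+1) g i ^+ ncoord i c = \prod_(j < n) g (c 0 j).
Proof.
move=> m1 gsym.
pose v j : nat := c 0 j; rewrite -[RHS]/(\prod_(j < n) g (v j)).
(* The ordinals of ['Z_m] are bounded by [(Zp_trunc m).+2], which equals [m] because 1 < m. *)
have vm j : (v j < m)%N by rewrite -[X in (_ < X)%N](Zp_cast m1) ltn_ord.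
pose f j : 'I_(m./2).+1 := inord (minn (v j) (m - v j)%N).
have fE j : f j = minn (v j) (m - v j)%N :> nat.
  by rewrite inordK //; move: (vm j); lia.
rewrite (partition_big f predT) //=; apply: eq_bigr => i _.
rewrite (_ : ncoord i c = #|[pred j | f j == i]|); last first.
  apply: eq_card => j; rewrite !inE; rewrite -[RHS]/(f j == i :> nat) fE.
  have im : (i < m)%N by have := ltn_ord i; lia.
  have -> : c 0 j = (v j)%:R by rewrite natr_Zp.
  rewrite ![(v j)%:R == _]eq_sym eqr_nat_Zp // eq_oppr_nat_Zp //.
  rewrite !modn_small //.
  apply/idP/eqP => [/orP[/eqP iv|/dvdnP[d ivm]]|<-].
  - by have := ltn_ord i; rewrite -iv; lia.
  (* In i + v = d m, d = 0 forces i = v = 0, d = 1 gives i = m - v, and d >= 2 is excluded by i, v <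
     m. *)
  - have := vm j; have := ltn_ord i; case: d ivm => [|[|d]] ivm; nia.
  - rewrite /minn; case: ifP => _; first by rewrite eqxx.
    by rewrite subnK ?dvdnn ?orbT // ltnW.
rewrite -prodr_const; apply: eq_bigr => j /eqP <-.
by rewrite fE /minn; case: ifP => // _; rewrite gsym.
Qed.

Theorem theorem2 (R : realType) (m n : nat) (hm : (2 <= m)%N)
    (C : {set 'rV['Z_m]_n}) (hC : linear_code C)
    (q : R) (hq0 : 0 <= q) (hq1 : q < 1) :
  Theta1 (constructionA R C) q =
  (1 / (1 - q ^+ m) ^+ n *
   mpoly.meval (fun i : 'I_(m./2).+1 => q ^+ i + q ^+ (m - i)) (swe R C))%:E.
Proof.
pose g r : R := q ^+ r + q ^+ (m - r).
have gsym r : (r < m)%N -> g (m - r)%N = g r.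
  by move=> rm; rewrite /g subKn ?(ltnW rm) // addrC.
have sweE : mpoly.meval (fun i : 'I_(m./2).+1 => g i) (swe R C) =
    \sum_(c in C) \prod_(j < n) g (c 0 j).
  rewrite /swe raddf_sum; apply: eq_bigr => c _.
  rewrite -(prod_exp_ncoord _ _ _ _ _ hm gsym).
  rewrite /= rmorph_prod; apply: eq_bigr => i _ /=.
  by rewrite rmorphXn /= mpoly.mevalXU.
rewrite [mpoly.meval _ _]sweE {sweE} /Theta1.
have -> : constructionA R C =
    ((fun z : 'rV[int]_n => \row_j (z 0 j)%:~R) @`
      [set z : 'rV[int]_n | reduce_mod m z \in C])%classic.
  by apply/seteqP; split=> [x [z Cz ->]|_ [z Cz <-]]; exists z.
rewrite esum_image; last first.
  move=> z w _ _ /rowP zw; apply/rowP => j.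
  by apply: (@intr_inj R); move: (zw j); rewrite !mxE.
(* The norm of an integer vector is a natural number, so for q >= 0 the real power is an ordinary
   one and splits over the coordinates. *)
have normE (z : 'rV[int]_n) :
    q `^ norm1 (\row_j (z 0 j)%:~R : 'rV[R]_n) = \prod_(j < n) q ^+ absz (z 0 j).
  rewrite prodrXr -powR_mulrn // natr_sum; congr powR; apply: eq_bigr => j _.
  by rewrite mxE -intr_norm.
under eq_esum do rewrite normE.
(* The lattice is cut into the fibres of [reduce_mod], one per codeword. *)
rewrite esum_partition_fin; last first.
  by move=> z; rewrite lee_fin prodr_ge0 // => j _; rewrite exprn_ge0.
rewrite div1r mulr_sumr -sumEFin; apply: eq_bigr => c _.
rewrite (_ : [set z | _]%classic =
    [set z : 'rV[int]_n | forall j, (z 0 j)%:~R = c 0 j]%classic); last first.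
  apply/seteqP; split=> z /=; first by move=> <- j; rewrite mxE.
  by move=> zc; apply/rowP => j; rewrite mxE.
(* A fibre is a product of residue classes, one per coordinate; the n equal denominators then
   collect into the prefactor. *)
rewrite (@esum_prod _ _ _ (fun j => [set t : int | t%:~R = c 0 j]%classic)
  (fun _ t => q ^+ `|t|%N) (fun j => g (c 0 j) / (1 - q ^+ m))) //.
- by rewrite big_split /= prodr_const card_ord exprVn mulrC.
- by move=> _ t; rewrite exprn_ge0.
move=> j; rewrite -(@esum_residue _ q m (c 0 j)) //; first by rewrite natr_Zp.
by rewrite -[X in (_ < X)%N](Zp_cast hm) ltn_ord.
Qed.
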